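(* Let $k,n$ be non-negative integers and $m\in\{0,1\}$. Let $p_1,\dots,p_{k+1}$ be primes (not necessarily distinct) with each $p_i\equiv 3,5,$ or $7\pmod 8$. Then for every integer $j$ not divisible by $p_{k+1}$, $$\mathcal{J}^*_{6}\Big(3^m p_1^2p_2^2\cdots p_k^2\,p_{k+1}\,\big(8p_{k+1}n+8j+p_{k+1}\big)\Big)\equiv 0\pmod 2.$$
   Context: Let $q=e^{2\pi i\tau}$, $(a;q)_\infty=\prod_{j\ge0}(1-aq^j)$, and $\eta(\tau)=q^{1/24}(q;q)_\infty$. Define $$j_6^{*}(\tau)=\left(\frac{\eta(\tau)\eta(3\tau)}{\eta(2\tau)\eta(6\tau)}\right)^6+6+2^6\left(\frac{\eta(2\tau)\eta(6\tau)}{\eta(\tau)\eta(3\tau)}\right)^6 = \frac1q+\sum_{n\ge 0}\mathcal{J}^*_6(n)q^n.$$ *)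

(* Defs.v *)
From HB Require Import structures.
From mathcomp Require Import all_boot all_order all_algebra.
Set Implicit Arguments. Unset Strict Implicit. Unset Printing Implicit Defensive.
Import Order.TTheory GRing.Theory Num.Theory.
Local Open Scope ring_scope.

Definition series := nat -> int.

Definition sone : series := fun n => (n == 0%N)%:R.

Definition smul (f g : series) : series :=
  fun n => \sum_(i < n.+1) f i * g (n - i)%N.

Definition spow (f : series) (e : nat) : series := iter e (smul f) sone.

(* Inverse of a series with constant term 1:
   b_0 = 1, b_n = - sum_{i=1}^n f_i b_{n-i}. *)
Fixpoint sinv_seq (f : series) (n : nat) : seq int :=
  match n with
  | 0%N => [:: 1]
  | n'.+1 => let s := sinv_seq f n' in
             rcons s (- \sum_(1 <= i < n'.+2) f i * nth 0 s (n'.+1 - i)%N)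
  end.
Definition sinv (f : series) : series := fun n => nth 0 (sinv_seq f n) n.

(* Infinite product prod_{j>=1} F j of series with F j = 1 + O(q^j):
   the coefficient of q^N only involves the factors j <= N. *)
Definition sprod (F : nat -> series) : series :=
  fun N => foldr smul sone [seq F j | j <- iota 1 N] N.

Definition qfac (a j : nat) : series :=
  fun i => if i == 0%N then 1 else if i == (a * j)%N then -1 else 0.

Definition qpoch (a : nat) : series := sprod (qfac a).

(* eta(t)eta(3t)/(eta(2t)eta(6t)) = q^(-1/6) * Etop/Ebot (as q-products, to the 1st power) *)
Definition Etop : series := smul (spow (qpoch 1) 6) (spow (qpoch 3) 6).
Definition Ebot : series := smul (spow (qpoch 2) 6) (spow (qpoch 6) 6).

(* (eta eta/eta eta)^6 = q^(-1) * Aser,  (eta eta/eta eta)^(-6) = q * Bser *)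
Definition Aser : series := smul Etop (sinv Ebot).
Definition Bser : series := smul Ebot (sinv Etop).

(* Jstar6 N = coefficient of q^N in j_6^*(tau) = q^-1 Aser + 6 + 64 q Bser,
   for every integer N (so Jstar6 (-1) = 1, and 0 for N <= -2). *)
Definition Jstar6 (N : int) : int :=
  match N with
  | Posz n => Aser n.+1 + (if n == 0%N then 6 else 0)
              + (if n is n'.+1 then 64 * Bser n' else 0)
  | Negz 0 => Aser 0
  | Negz _ => 0
  end.

(* Main.v *)
(* Modulo 2, [f ^ 2] is [f] with [q] replaced by [q^2], so with u = (q;q)^3 and
   v = (q^3;q^3)^3 one has q j_6^* = (u v)^-2.  By Gauss and Jacobi u and v are the
   series of q^T and q^(3T), T triangular, and u v = u^4 + q v^4 mod 2.  Expanding
   (u v)^-2 = (u v)^-8 (u v)^2 (u v)^4 with this relation gives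
     (u v)^-2 = (u^2/v)^8 + q^4 v^8 + q^2 u^8 + q^6 (v^2/u)^8,
   in which eighth powers are series in q^8.  Hence, for m <= 1, the coefficient at
   N = 3^m mod 8 can be odd only when N is 3^m times a square; this is impossible
   here because p_(k+1) divides N / 3^m to an odd power. *)

Require Import Defs.
From HB Require Import structures.
From mathcomp Require Import all_boot all_order all_algebra.
From mathcomp Require Import boolp zify ring.
Import Order.TTheory GRing.Theory Num.Theory.
Local Open Scope ring_scope.

(** * Formal power series *)

(** A record rather than bare functions, so that the Cauchy product can be registered as its ring
    multiplication and [ring] applies to series. *)
Record fps (R : comNzRingType) : Type := Fps { fcoef :> nat -> R }.

HB.instance Definition _ (R : comNzRingType) := gen_eqMixin (fps R).
HB.instance Definition _ (R : comNzRingType) := gen_choiceMixin (fps R).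

Lemma fpsP {R : comNzRingType} (f g : fps R) : (forall n, f n = g n) -> f = g.
Proof. by case: f g => f [g] /= fg; congr Fps; apply: funext. Qed.

Definition fps_zero (R : comNzRingType) : fps R := Fps R (fun _ => 0).
Definition fps_one (R : comNzRingType) : fps R := Fps R (fun n => (n == 0%N)%:R).
Definition fps_opp {R : comNzRingType} (f : fps R) : fps R := Fps R (fun n => - f n).
Definition fps_add {R : comNzRingType} (f g : fps R) : fps R :=
  Fps R (fun n => f n + g n).
Definition fps_mul {R : comNzRingType} (f g : fps R) : fps R :=
  Fps R (fun n => \sum_(i < n.+1) f i * g (n - i)%N).

Lemma fps_addA (R : comNzRingType) : associative (@fps_add R).
Proof. by move=> f g h; apply: fpsP => n /=; rewrite addrA. Qed.

Lemma fps_addC (R : comNzRingType) : commutative (@fps_add R).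
Proof. by move=> f g; apply: fpsP => n /=; rewrite addrC. Qed.

Lemma fps_add0 (R : comNzRingType) : left_id (fps_zero R) fps_add.
Proof. by move=> f; apply: fpsP => n /=; rewrite add0r. Qed.

Lemma fps_addN (R : comNzRingType) : left_inverse (fps_zero R) fps_opp fps_add.
Proof. by move=> f; apply: fpsP => n /=; rewrite addNr. Qed.

HB.instance Definition _ (R : comNzRingType) :=
  GRing.isZmodule.Build (fps R)
    (@fps_addA R) (@fps_addC R) (@fps_add0 R) (@fps_addN R).

(** Coefficient [n] of a product sees only coefficients up to [n], so ring laws can be borrowed from
    truncations in [{poly R}]. *)
Lemma fps_mulE {R : comNzRingType} (N : nat) (f g : fps R) (p r : {poly R}) n :
  (n < N)%N -> (forall i, (i < N)%N -> f i = p`_i) ->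
  (forall i, (i < N)%N -> g i = r`_i) -> fps_mul f g n = (p * r)`_n.
Proof.
move=> nN fp gr; rewrite coefM; apply: eq_bigr => i _.
by have ? := ltn_ord i; rewrite fp ?gr //; lia.
Qed.

Definition fps_trunc {R : comNzRingType} (N : nat) (f : fps R) : {poly R} :=
  \poly_(i < N) f i.

Lemma coef_trunc {R : comNzRingType} (N : nat) (f : fps R) i :
  (i < N)%N -> f i = (fps_trunc N f)`_i.
Proof. by rewrite coef_poly => ->. Qed.

Lemma fps_mulC (R : comNzRingType) : commutative (@fps_mul R).
Proof.
move=> f g; apply: fpsP => n.
by rewrite !(@fps_mulE _ n.+1 _ _ _ _ n _ (coef_trunc n.+1 _) (coef_trunc n.+1 _)) // mulrC.
Qed.

Lemma fps_mulA (R : comNzRingType) : associative (@fps_mul R).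
Proof.
move=> f g h; apply: fpsP => n; pose N := n.+1; pose t := @fps_trunc R N.
have tM u v i : (i < N)%N -> fps_mul u v i = (t u * t v)`_i.
  by move=> iN; apply: (fps_mulE N) => // k; apply: coef_trunc.
rewrite (@fps_mulE _ N f _ (t f) (t g * t h)) ?(@fps_mulE _ N _ h (t f * t g) (t h)) ?mulrA //;
  by [apply: tM | apply: coef_trunc].
Qed.

Lemma fps_mul1 (R : comNzRingType) : left_id (fps_one R) fps_mul.
Proof.
move=> f; apply: fpsP => n /=; rewrite big_ord_recl /= mul1r subn0 big1 ?addr0 //.
by move=> i _; rewrite /= mul0r.
Qed.

Lemma fps_mulDl (R : comNzRingType) : left_distributive (@fps_mul R) fps_add.
Proof.
move=> f g h; apply: fpsP => n /=; rewrite -big_split /=.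
by apply: eq_bigr => i _; rewrite mulrDl.
Qed.

Lemma fps_one_neq0 (R : comNzRingType) : fps_one R != 0.
Proof.
apply/eqP => /(congr1 (fun f : fps R => f 0%N)) /= /eqP.
by rewrite oner_eq0.
Qed.

HB.instance Definition _ (R : comNzRingType) :=
  GRing.Zmodule_isComNzRing.Build (fps R) (@fps_mulA R) (@fps_mulC R)
    (@fps_mul1 R) (@fps_mulDl R) (@fps_one_neq0 R).

Lemma fcoefD {R : comNzRingType} (f g : fps R) n : (f + g) n = f n + g n.
Proof. by []. Qed.

Lemma fcoefN {R : comNzRingType} (f : fps R) n : (- f) n = - f n.
Proof. by []. Qed.

Lemma fcoef1 {R : comNzRingType} n : (1 : fps R) n = (n == 0%N)%:R.
Proof. by []. Qed.

Lemma fcoefM {R : comNzRingType} (f g : fps R) n :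
  (f * g) n = \sum_(i < n.+1) f i * g (n - i)%N.
Proof. by []. Qed.

Lemma fcoef_sum {R : comNzRingType} (I : Type) (r : seq I) (P : pred I)
    (F : I -> fps R) n :
  (\sum_(i <- r | P i) F i) n = \sum_(i <- r | P i) F i n.
Proof. by apply: (big_morph (fun f : fps R => f n)). Qed.


(** * Congruence modulo q^N, used to compare infinite products with finite ones *)

Definition eqm {R : comNzRingType} (N : nat) (f g : fps R) : Prop :=
  forall i, (i < N)%N -> f i = g i.

Lemma eqm_trans {R : comNzRingType} (N : nat) (g f h : fps R) :
  eqm N f g -> eqm N g h -> eqm N f h.
Proof. by move=> fg gh i iN; rewrite fg // gh. Qed.

Lemma eqm_sym {R : comNzRingType} (N : nat) (f g : fps R) : eqm N f g -> eqm N g f.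
Proof. by move=> fg i iN; rewrite fg. Qed.

Lemma eqm_le {R : comNzRingType} (M N : nat) (f g : fps R) :
  (M <= N)%N -> eqm N f g -> eqm M f g.
Proof. by move=> MN fg i iM; apply: fg; apply: leq_trans MN. Qed.

Lemma eqmM {R : comNzRingType} (N : nat) (f1 g1 f2 g2 : fps R) :
  eqm N f1 g1 -> eqm N f2 g2 -> eqm N (f1 * f2) (g1 * g2).
Proof.
move=> e1 e2 n nN; rewrite !fcoefM; apply: eq_bigr => i _.
by have := ltn_ord i => ?; rewrite e1 ?e2 //; lia.
Qed.

Lemma eqmX {R : comNzRingType} (N : nat) (f g : fps R) k :
  eqm N f g -> eqm N (f ^+ k) (g ^+ k).
Proof. by move=> e; elim: k => // k IH; rewrite !exprS; apply: eqmM. Qed.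

Lemma fps_eqm {R : comNzRingType} (f g : fps R) : (forall N, eqm N f g) -> f = g.
Proof. by move=> e; apply: fpsP => n; apply: (e n.+1). Qed.

Definition mon (R : comNzRingType) (k : nat) : fps R :=
  Fps R (fun n => (n == k)%:R).

Lemma fcoef_mon {R : comNzRingType} k n : mon R k n = (n == k)%:R.
Proof. by []. Qed.

Lemma fcoef_monM {R : comNzRingType} k (f : fps R) n :
  (mon R k * f) n = if (k <= n)%N then f (n - k)%N else 0.
Proof.
rewrite fcoefM; case: leqP => kn; last first.
  by rewrite big1 // => i _; rewrite /= [_ == _]ltn_eqF ?mul0r //; have := ltn_ord i; lia.
have kn' : (k < n.+1)%N by [].
rewrite (bigD1 (Ordinal kn')) //= eqxx mul1r big1 ?addr0 // => i /eqP ik.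
by rewrite (_ : (i == k :> nat) = false) ?mul0r //; apply/eqP => e; apply: ik; apply: val_inj.
Qed.

Lemma monD {R : comNzRingType} a b : mon R (a + b) = mon R a * mon R b.
Proof.
apply: fpsP => n; rewrite fcoef_monM !fcoef_mon.
case: leqP => h; first by have -> : (n == a + b)%N = (n - a == b)%N by lia.
by have -> : (n == a + b)%N = false by lia.
Qed.

Lemma mon0 {R : comNzRingType} : mon R 0 = 1.
Proof. by apply: fpsP. Qed.

Lemma monX {R : comNzRingType} a n : mon R a ^+ n = mon R (a * n).
Proof. by elim: n => [|n IH]; rewrite ?muln0 ?mon0 // exprS IH mulnS monD. Qed.

Lemma eqm_monM {R : comNzRingType} N k (f : fps R) :
  (N <= k)%N -> eqm N (f * mon R k) 0.
Proof. by move=> Nk i iN; rewrite mulrC fcoef_monM leqNgt (leq_trans iN Nk). Qed.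

Lemma eqm_sub_mon {R : comNzRingType} N k (f : fps R) :
  (N <= k)%N -> eqm N (f * (1 - mon R k)) f.
Proof. by move=> Nk i iN; rewrite mulrBr mulr1 fcoefD fcoefN (eqm_monM N) ?subr0. Qed.

(** * Reduction of integer series *)

Definition red (R : comNzRingType) (f : series) : fps R :=
  Fps R (fun n => (f n)%:~R).

Lemma red_mul {R : comNzRingType} f g : red R (smul f g) = red R f * red R g.
Proof.
apply: fpsP => n; rewrite fcoefM /= /smul rmorph_sum /=.
by apply: eq_bigr => i _; rewrite rmorphM.
Qed.

Lemma red_one {R : comNzRingType} : red R sone = 1.
Proof. by apply: fpsP => n; rewrite fcoef1 /= /sone; case: (n == 0)%N. Qed.

Lemma red_pow {R : comNzRingType} f e : red R (spow f e) = red R f ^+ e.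
Proof.
by elim: e => [|e IH]; [apply: red_one | rewrite /spow iterS red_mul IH exprS].
Qed.

Lemma size_sinv_seq f n : size (sinv_seq f n) = n.+1.
Proof. by elim: n => // n IH; rewrite /= size_rcons IH. Qed.

Lemma nth_sinv_seq f n i : (i <= n)%N -> nth 0 (sinv_seq f n) i = sinv f i.
Proof.
elim: n => [|n IH]; first by rewrite leqn0 => /eqP ->.
rewrite leq_eqVlt => /orP [/eqP -> // | lin].
by rewrite /= nth_rcons size_sinv_seq lin IH.
Qed.

Lemma sinvS f n :
  sinv f n.+1 = - \sum_(1 <= i < n.+2) f i * sinv f (n.+1 - i)%N.
Proof.
rewrite /sinv /= nth_rcons size_sinv_seq ltnn eqxx; congr (- _).
by apply: eq_big_nat => i /andP [i0 iN]; rewrite nth_sinv_seq //; lia.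
Qed.

(** The recursion defining [sinv] says exactly that the product has no coefficient of positive
    index. *)
Lemma red_mulV {R : comNzRingType} f : f 0%N = 1 -> red R f * red R (sinv f) = 1.
Proof.
move=> f0; rewrite -red_mul -red_one; apply: fpsP => n /=; congr (_%:~R).
rewrite /smul /sone; case: n => [|n]; first by rewrite big_ord1 f0.
rewrite -(big_mkord xpredT (fun i => f i * sinv f (n.+1 - i)%N)) big_nat_recl //.
rewrite f0 mul1r subn0 sinvS big_add1 /=; exact: addNr.
Qed.

Lemma red_foldr {R : comNzRingType} (F : nat -> series) (s : seq nat) :
  red R (foldr smul sone [seq F j | j <- s]) = \prod_(j <- s) red R (F j).
Proof.
elim: s => [|j s IH]; first by rewrite big_nil red_one.
by rewrite big_cons /= red_mul IH.
Qed.

Lemma red_qfac {R : comNzRingType} a j :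
  (0 < a * j)%N -> red R (qfac a j) = 1 - mon R (a * j).
Proof.
move=> aj; apply: fpsP => n; rewrite fcoefD fcoefN fcoef1 fcoef_mon /= /qfac.
case: eqVneq => [->|n0]; first by rewrite ltn_eqF // subr0.
by case: eqP => _; rewrite ?sub0r ?subr0 ?oppr0 // rmorphN1.
Qed.

Definition poch {R : comNzRingType} (x : R) (n : nat) : R :=
  \prod_(0 <= i < n) (1 - x ^+ i.+1).

(** Coefficient [i] of the infinite product uses the first [i] factors; each later factor is 1 +
    O(q^(i+1)), so going on to [n] factors does not change it. *)
Lemma red_qpoch {R : comNzRingType} a n :
  (0 < a)%N -> eqm n.+1 (red R (qpoch a)) (poch (mon R a) n).
Proof.
move=> a0 i iN; pose P m := \prod_(j <- iota 1 m) red R (qfac a j).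
have -> : red R (qpoch a) i = P i i by rewrite /P -red_foldr.
have -> : poch (mon R a) n = P n.
  have iotaE : iota 1 n = index_iota 1 n.+1 by rewrite /index_iota subn1.
  rewrite /P /poch iotaE big_add1 /=.
  by apply: eq_bigr => j _; rewrite monX red_qfac ?muln_gt0 ?a0.
suff: forall d, eqm i.+1 (P (i + d)%N) (P i).
  by move=> /(_ (n - i)%N) <- //; rewrite subnKC.
elim=> [|d IH]; first by rewrite addn0.
rewrite addnS /P -[X in iota 1 X]addn1 iotaD big_cat big_cons big_nil /= mulr1.
rewrite red_qfac ?muln_gt0 ?a0 //; apply: eqm_trans IH.
by apply: eqm_sub_mon; nia.
Qed.

(** * Gauss's triangular number series *)

Definition tri (t : nat) : nat := (t * t.+1)./2.

Arguments tri : simpl never.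

Lemma tri2 t : (2 * tri t = t * t.+1)%N.
Proof. by rewrite /tri mul2n halfK oddM /= andbN subn0. Qed.

Lemma leq_tri t : (t <= tri t)%N.
Proof. by have := tri2 t; nia. Qed.

(** Shanks's finite form of Gauss's identity, with denominators cleared. For large [n] only the term
    [s = 0] on the right has low order, which leaves the product of the even factors. *)
Lemma Shanks {R : comNzRingType} (x : R) (n : nat) :
  (\prod_(0 <= i < n) (1 - x ^+ (2 * i).+1)) * (\sum_(0 <= j < 2 * n) x ^+ tri j)
  = \sum_(0 <= s < n) (\prod_(s <= i < n) (1 - x ^+ (2 * i).+2)) *
      (\prod_(0 <= i < s) (1 - x ^+ (2 * i).+1)) * x ^+ (s * (2 * n).+1).
Proof.
elim: n => [|n IH]; first by rewrite !big_geq // mulr0.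
pose B s := \prod_(0 <= i < s) (1 - x ^+ (2 * i).+1).
pose A s := \prod_(s <= i < n) (1 - x ^+ (2 * i).+2).
pose d s := A s * B s * x ^+ (s * (2 * n).+1).
pose o := 1 - x ^+ (2 * n).+1; pose e := 1 - x ^+ (2 * n).+2.
have Bs s : B s.+1 = B s * (1 - x ^+ (2 * s).+1) by rewrite /B big_nat_recr.
(* Passing from [n] to [n.+1] multiplies the summand [d s] by [e * x ^+ (2 * s)], and the odd
   product on the left by [o]; the difference telescopes. *)
have tele m : (m <= n)%N ->
    \sum_(0 <= s < m) d s * (e * x ^+ (2 * s) - o) = (1 - x ^+ (2 * m)) * d m.
  elim: m => [|m IHm] mn; first by rewrite big_geq // subrr mul0r.
  rewrite big_nat_recr //= IHm 1?ltnW // /d Bs.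
  have -> : A m = (1 - x ^+ (2 * m).+2) * A m.+1 by rewrite /A big_ltn.
  rewrite (mulnS 2 m) (mulSn m) /e /o.
  by move: (2 * m)%N (2 * n)%N (m * _)%N => k l r; rewrite !exprD !exprS; ring.
have dn : d n = B n * x ^+ tri (2 * n).
  rewrite /d /A big_geq // mul1r; congr (_ * x ^+ _).
  by have := tri2 (2 * n); nia.
(* What telescoping leaves is the contribution of the new exponent tri (2n+1); that of tri (2n) is
   [o * d n]. *)
have total : \sum_(0 <= s < n.+1) d s * (e * x ^+ (2 * s) - o)
    = o * B n * x ^+ tri (2 * n).+1.
  rewrite big_nat_recr //= tele // dn.
  have -> : tri (2 * n).+1 = (tri (2 * n) + (2 * n).+1)%N.
    by have := (tri2 (2 * n), tri2 (2 * n).+1); case; nia.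
  rewrite /e /o; move: (2 * n)%N (B n) => k b; rewrite !exprD !exprS; ring.
transitivity (\sum_(0 <= s < n.+1) d s * (e * x ^+ (2 * s))); last first.
  apply: eq_big_nat => s /andP [_ sn].
  rewrite (big_nat_recr n) //= -/(A s) -/(B s) -/e /d.
  have -> : (s * (2 * n.+1).+1 = s * (2 * n).+1 + 2 * s)%N by nia.
  by rewrite exprD; ring.
have -> : \sum_(0 <= s < n.+1) d s * (e * x ^+ (2 * s))
    = o * B n * x ^+ tri (2 * n).+1 + (\sum_(0 <= s < n.+1) d s) * o.
  rewrite -total mulr_suml -big_split /=.
  by apply: eq_bigr => s _; ring.
have -> : (2 * n.+1 = (2 * n).+2)%N by lia.
rewrite -/(B n.+1) Bs -/o !big_nat_recr //= dn -IH -/(B n); ring.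
Qed.

Lemma poch_double {R : comNzRingType} (x : R) n :
  (\prod_(0 <= i < n) (1 - x ^+ (2 * i).+1)) *
    (\prod_(0 <= i < n) (1 - x ^+ (2 * i).+2)) = poch x (2 * n).
Proof.
elim: n => [|n IH]; first by rewrite /poch !big_geq // mulr1.
have -> : (2 * n.+1 = (2 * n).+2)%N by lia.
by rewrite /poch !big_nat_recr //= -/(poch x (2 * n)) -IH; ring.
Qed.

(** Ramanujan's psi(q^a) modulo 2. Stopping at t = n loses nothing when a > 0, since t <= tri t. *)
Definition psi (a : nat) : fps 'F_2 :=
  Fps _ (fun n => \sum_(0 <= t < n.+1) (a * tri t == n)%:R).

Lemma eqm_psi a N M : (0 < a)%N -> (N <= M)%N ->
  eqm N (psi a) (\sum_(0 <= t < M) mon 'F_2 (a * tri t)).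
Proof.
move=> a0 NM i iN; rewrite fcoef_sum (big_cat_nat (n := i.+1)) //=; last by lia.
rewrite [X in _ = _ + X]big_nat_cond [X in _ = _ + X]big1 ?addr0.
  by apply: eq_bigr => t _; rewrite eq_sym.
move=> t /andP [/andP [it _] _]; rewrite /= ltn_eqF //.
by have := leq_tri t; nia.
Qed.

Lemma addrr_F2 (x : 'F_2) : x + x = 0.
Proof. by apply: addrr_pchar2; apply: pchar_Fp. Qed.

Lemma pchar_fps2 : 2%N \in [pchar (fps 'F_2)].
Proof.
rewrite inE; apply/andP; split; first by [].
by apply/eqP/fpsP => n; rewrite mulr2n fcoefD; exact: addrr_F2.
Qed.

Lemma poch_sqr {R : comNzRingType} (x : R) n :
  2%N \in [pchar R] -> poch x n ^+ 2 = poch (x ^+ 2) n.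
Proof.
move=> R2; rewrite /poch -prodrXl; apply: eq_bigr => i _.
rewrite !(oppr_pchar2 R2) exprDn_pchar; last by rewrite pnatE.
by rewrite expr1n -!exprM mulnC.
Qed.

Definition euler (a : nat) : fps 'F_2 := red _ (qpoch a).

Lemma euler_sqr a : (0 < a)%N -> euler a ^+ 2 = euler (2 * a).
Proof.
move=> a0; apply: fps_eqm => N; apply: (@eqm_le _ N N.+1) => //.
apply: eqm_trans (eqmX _ _ _ 2 (red_qpoch a N a0)) _.
rewrite (poch_sqr _ _ pchar_fps2) monX mulnC; apply/eqm_sym/red_qpoch.
by rewrite muln_gt0.
Qed.

Lemma euler_unit a : exists g, euler a * g = 1.
Proof. by exists (red _ (sinv (qpoch a))); apply: red_mulV. Qed.

(** Let A and B be the products of the even and odd factors. Gauss's identity reads B psi = A, and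
    euler = B A, while squaring modulo 2 gives euler^2 = A. Hence euler psi = A^2 = euler^4. *)
Lemma eulerM_psi a : (0 < a)%N -> euler a * psi a = euler a ^+ 4.
Proof.
move=> a0; apply: fps_eqm => N; apply: (@eqm_le _ N N.+1) => //; set x := mon 'F_2 a.
pose A := \prod_(0 <= i < N.+1) (1 - x ^+ (2 * i).+2).
pose B := \prod_(0 <= i < N.+1) (1 - x ^+ (2 * i).+1).
have FAB : eqm N.+1 (euler a) (B * A).
  rewrite poch_double; apply: eqm_le (red_qpoch _ _ a0); lia.
have FA : eqm N.+1 (euler a ^+ 2) A.
  apply: (@eqm_le _ _ N.+2) => //; apply: eqm_trans (eqmX _ _ _ 2 (red_qpoch a N.+1 a0)) _.
  rewrite (poch_sqr _ _ pchar_fps2) /poch /A (eq_bigr (fun i => 1 - x ^+ (2 * i).+2)) // => i _.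
  by rewrite -exprM mulnS.
have sh : eqm N.+1 (B * psi a) A.
  apply: (@eqm_trans _ _ (B * \sum_(0 <= j < 2 * N.+1) x ^+ tri j)).
    apply: eqmM => //; under eq_bigr do rewrite monX.
    by apply: eqm_psi => //; lia.
  (* Only [s = 0] survives: the other terms have order at least a (2N + 3). *)
  rewrite Shanks big_nat_recl // mul0n expr0 mulr1 [X in _ * X + _]big_geq // mulr1 => i iN.
  rewrite fcoefD fcoef_sum [X in _ + X]big1 ?addr0 // => s _.
  by rewrite monX (eqm_monM N.+1) //; nia.
apply: eqm_trans (eqmM _ _ _ _ _ FAB (fun i _ => erefl)) _.
rewrite (_ : euler a ^+ 4 = euler a ^+ 2 * euler a ^+ 2); last by rewrite -exprD.
apply: (eqm_trans _ (A * A)); last by apply: eqm_sym; apply: eqmM.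
by rewrite mulrAC; apply: eqmM.
Qed.

(** Jacobi's formula for the cube of the Euler product, modulo 2; here it follows by cancelling one
    Euler product. *)
Lemma psiE a : (0 < a)%N -> psi a = euler a ^+ 3.
Proof.
move=> a0; have [g gE] := euler_unit a.
by rewrite -[psi a]mul1r -gE mulrAC eulerM_psi // exprSr -mulrA gE mulr1.
Qed.

(** * A modular equation of degree 3 *)

(** In characteristic 2 the two members of an orbit {x, g x} cancel, so only fixed points
    contribute. *)
Lemma sum_involution (T : finType) (A : pred T) (g : T -> T) (F : T -> 'F_2) :
  (forall x, A x -> A (g x)) -> (forall x, A x -> g (g x) = x) ->
  (forall x, A x -> F (g x) = F x) ->
  \sum_(x | A x) F x = \sum_(x | A x && (g x == x)) F x.
Proof.
move=> gA gK gF; rewrite (bigID (fun x => g x == x)) /=.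
(* [enum_rank] selects one point in each orbit of size two; [g] carries one half of the sum onto the
   other. *)
rewrite [X in _ + X](bigID (fun x => enum_rank x < enum_rank (g x))%N) /=.
set S := (X in _ + (X + _)); set S' := (X in _ + (_ + X)).
suff -> : S' = S by rewrite addrr_F2 addr0.
rewrite /S' (reindex_onto g g) /=; last by move=> x /andP [/andP [/gK]].
rewrite /S; apply: eq_big => [x|x /andP [/andP [/andP [Ax _] _] /eqP gx]]; last first.
  by have := gF _ Ax; rewrite gx.
have rankE (y z : T) : (enum_rank y == enum_rank z :> nat) = (y == z).
  by rewrite -(inj_eq enum_rank_inj).
apply/idP/idP => [/andP [/andP [/andP [Agx ne] le] /eqP gx]|/andP [/andP [Ax ne] lt]].
  move: (gA _ Agx) ne le; rewrite gx => -> ne /=; rewrite eq_sym ne -leqNgt => le.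
  by rewrite ltn_neqAle rankE ne.
by rewrite gA // gK // eqxx eq_sym ne -leqNgt ltnW.
Qed.

(** The involution i -> n - i pairs off the Cauchy product and leaves the middle term, a square in
    F_2, where x^2 = x. *)
Lemma fps2_sqr_coef (f : fps 'F_2) n :
  (f ^+ 2) n = if odd n then 0 else f n./2.
Proof.
rewrite expr2 fcoefM (@sum_involution _ xpredT (@rev_ord n.+1)) //=.
- under eq_bigl => i do rewrite -(inj_eq val_inj) /=.
  case: ifPn => nodd.
    by rewrite big_pred0 // => i; apply/eqP; move: (ltn_ord i) nodd; lia.
  have hn : (n./2 < n.+1)%N by lia.
  rewrite (big_pred1 (Ordinal hn)) => [|i] /=.
    rewrite (_ : (n - n./2 = n./2)%N); last by lia.
    by case: (f _) => -[|[|]] // ?; apply: val_inj.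
  by rewrite -(inj_eq val_inj) /=; move: (ltn_ord i) nodd; lia.
- by move=> i _; apply: rev_ordK.
- move=> i _; rewrite mulrC; congr (f _ * f _); have := ltn_ord i; lia.
Qed.

(** Three squarings give f^8 = f(q^8), so q^k f^8 carries the coefficients of [f] in the residue
    class of [k] modulo 8 alone. *)
Lemma fps2_oct_coef k (f : fps 'F_2) r n : (k < 8)%N -> (r < 8)%N ->
  (mon _ k * f ^+ 8) (8 * n + r)%N = if k == r then f n else 0.
Proof.
move=> k8 r8; rewrite (exprM f 4 2) (exprM f 2 2) fcoef_monM !fps2_sqr_coef.
case: eqVneq => [->|kr].
  rewrite leq_addl addnK; have -> : ((8 * n)./2 = 4 * n)%N by lia.
  have -> : ((4 * n)./2 = 2 * n)%N by lia.
  have -> : ((2 * n)./2 = n)%N by lia.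
  by rewrite !oddM.
case: leqP => // kn; do 3! [case: ifP => //]; lia.
Qed.

Lemma psi_sqr a : (0 < a)%N -> psi a ^+ 2 = psi (2 * a).
Proof. by move=> a0; rewrite !psiE ?muln_gt0 // -exprM mulnC exprM euler_sqr. Qed.

(* For odd x = 2s + 1 and y = 2t + 1 this multiplies x + y sqrt(-3) by the
   primitive cube root of unity that keeps both coordinates odd, up to signs. *)
Definition eisenstein (p : nat * nat) : nat * nat :=
  let: (s, t) := p in
  if odd (s + t) then ((s + 3 * t).+1./2, if (t < s)%N then (s - t)./2 else (t - s)./2)
  else (if (3 * t < s)%N then (s - 3 * t - 2)./2 else (3 * t - s)./2, (s + t)./2).

(** With x = 2s + 1 and y = 2t + 1, the number 8 (tri s + 3 tri t) + 4 is the norm x^2 + 3 y^2,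
    which a unit preserves. *)
Lemma eisenstein_norm s t :
  let: (s', t') := eisenstein (s, t) in
  (tri s' + 3 * tri t' = tri s + 3 * tri t)%N.
Proof.
rewrite /eisenstein.
case: ifPn => st; case: ifPn => lt;
 match goal with |- (tri ?a + 3 * tri ?b = _)%N =>
   have := (tri2 a, tri2 b, tri2 s, tri2 t); set A := a; set B := b end;
 case => -[[hA hB] hs ht].
- have eA : (2 * A = s + 3 * t + 1)%N by lia. have eB : (2 * B + 1 = s - t)%N by lia.
  nia.
- have eA : (2 * A = s + 3 * t + 1)%N by lia. have eB : (2 * B + 1 = t - s)%N by lia.
  nia.
- have eA : (2 * A + 2= s - 3 * t)%N by lia. have eB : (2 * B = t + s)%N by lia.
  nia.
- have eA : (2 * A = 3 * t - s)%N by lia. have eB : (2 * B = t + s)%N by lia.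
  nia.
Qed.

(** Exactly one of the two primitive cube roots keeps both coordinates odd. At the image it is, up
    to the discarded signs, the conjugate root, which leads back. *)
Lemma eisensteinK : involutive eisenstein.
Proof.
move=> [s t]; rewrite /eisenstein.
case: (ltnP t s) => ?; case: (ltnP (3 * t) s) => ?; case: ifPn => ?; case: ifPn => ?; (try case: ifPn => ?); congr pair; lia.
Qed.

(** On these two families tri s + 3 tri t becomes 4 tri t and 1 + 12 tri t, the exponents on the
    right of [modular3]. *)
Lemma eisenstein_fix s t :
  (eisenstein (s, t) == (s, t)) = (s == t) || (s == 3 * t + 1)%N.
Proof.
rewrite /eisenstein; case: ifPn => st; case: ifPn => lt; rewrite xpair_eqE; lia.
Qed.

Lemma sum_delta (R : nzRingType) (P : pred nat) c K :
  \sum_(0 <= s < K) (P s && (s == c))%:R = (P c && (c < K)%N)%:R :> R.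
Proof.
transitivity (\sum_(0 <= s < K | s == c) (P s)%:R : R).
  by rewrite [RHS]big_mkcond /=; apply: eq_bigr => s _; case: (P s); case: (s == c).
by rewrite big_nat1_eq; case: (c < K)%N; rewrite ?andbT ?andbF.
Qed.

(** This is coefficient [n] of [modular3]: [eisenstein] acts on the solutions counted on the left,
    and the right counts its fixed points. *)
Lemma sum_eisenstein n :
  \sum_(0 <= s < n.+1) \sum_(0 <= t < n.+1) (tri s + 3 * tri t == n)%N%:R =
  \sum_(0 <= t < n.+1) ((4 * tri t == n)%N%:R + (1 + 12 * tri t == n)%N%:R) :> 'F_2.
Proof.
pose val2 (p : 'I_n.+1 * 'I_n.+1) : nat * nat := (val p.1, val p.2).
have val2I : injective val2.
  by move=> [s t] [s' t'] [/val_inj /= -> /val_inj /= ->].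
pose A p := (tri (val2 p).1 + 3 * tri (val2 p).2 == n)%N.
(* [inord] is faithful here on solutions, where the preserved value [n] of the form bounds both new
   coordinates. *)
pose g p : 'I_n.+1 * 'I_n.+1 :=
  let e := eisenstein (val2 p) in (inord e.1, inord e.2).
have normE p : (tri (eisenstein p).1 + 3 * tri (eisenstein p).2 = tri p.1 + 3 * tri p.2)%N.
  by case: p => s t; have := eisenstein_norm s t; case: eisenstein.
have gE p : A p -> val2 (g p) = eisenstein (val2 p).
  rewrite /A -normE /g; case: eisenstein => s t /= /eqP e.
  have := (leq_tri s, leq_tri t); case=> hs ht.
  by congr pair; rewrite /= inordK //; lia.
have -> : \sum_(0 <= s < n.+1) \sum_(0 <= t < n.+1) (tri s + 3 * tri t == n)%N%:R
    = \sum_(p | A p) 1 :> 'F_2.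
  rewrite big_mkord; under eq_bigr do rewrite big_mkord.
  by rewrite pair_big /= [RHS]big_mkcond /=; apply: eq_bigr => p _; rewrite /A /=; case: eqP.
rewrite (@sum_involution _ A g) //.
- have -> : \sum_(p | A p && (g p == p)) 1 = \sum_(0 <= s < n.+1) \sum_(0 <= t < n.+1)
     (((tri s + 3 * tri t == n)%N && (s == t))%:R +
      ((tri s + 3 * tri t == n)%N && (s == 3 * t + 1)%N)%:R) :> 'F_2.
    rewrite big_mkord; under [RHS]eq_bigr do rewrite big_mkord.
    rewrite pair_big /= big_mkcond; apply: eq_bigr => p _.
    rewrite -/(A p); case Ap: (A p); last by rewrite addr0.
    rewrite -(inj_eq val2I) gE // eisenstein_fix /=.
    case: eqP => [->|_] /=; last by rewrite add0r; case: (_ == _).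
    by rewrite (_ : (_ == _) = false) ?addr0 //; lia.
  rewrite exchange_big /=; apply: eq_big_nat => t /andP [_ tn].
  rewrite big_split /= !sum_delta /= tn andbT; congr (_%:R + _%:R).
  have := (tri2 t, tri2 (3 * t + 1), leq_tri t); case; case => h1 h2 h3.
  have -> : (tri (3 * t + 1) + 3 * tri t = 1 + 12 * tri t)%N by nia.
  by case: eqP => //= <-; nia.
- by move=> p Ap; rewrite /A gE // normE.
- by move=> p Ap; apply: val2I; rewrite !gE ?eisensteinK // /A gE // normE.
Qed.

Lemma modular3 : psi 1 * psi 3 = psi 4 + mon _ 1 * psi 12.
Proof.
apply: fpsP => n; pose S a := \sum_(0 <= t < n.+1) mon 'F_2 (a * tri t).
have eS a : (0 < a)%N -> eqm n.+1 (psi a) (S a) by move=> a0; apply: eqm_psi.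
rewrite (eqmM _ _ _ _ _ (eS 1 isT) (eS 3 isT)) // fcoefD eS //.
rewrite (eqmM n.+1 (mon _ 1) (mon _ 1) _ _ (fun _ _ => erefl) (eS 12 isT)) //.
rewrite /S mulr_suml mulr_sumr !fcoef_sum -big_split.
transitivity (\sum_(0 <= s < n.+1) \sum_(0 <= t < n.+1) (tri s + 3 * tri t == n)%N%:R : 'F_2).
  apply: eq_bigr => s _; rewrite mulr_sumr fcoef_sum; apply: eq_bigr => t _.
  by rewrite -monD fcoef_mon mul1n eq_sym.
rewrite sum_eisenstein; apply: eq_bigr => t _.
by rewrite -monD !fcoef_mon !(eq_sym n).
Qed.

(** * The coefficients of j_6^* modulo 2 *)

(** The inverses enter as elements [U] and [V] with uU = vV = 1, so the dissection is a polynomial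
    identity modulo these relations; powers of uU and vV are inserted where [ring] needs them. *)
Lemma dissection8 (R : comNzRingType) (A q u v U V : R) :
  2%N \in [pchar R] -> u * U = 1 -> v * V = 1 ->
  u * v = u ^+ 4 + q * v ^+ 4 -> A * (u * v) ^+ 2 = 1 ->
  A = (u ^+ 2 * V) ^+ 8 + q ^+ 4 * v ^+ 8 + q ^+ 2 * u ^+ 8
      + q ^+ 6 * (v ^+ 2 * U) ^+ 8.
Proof.
move=> R2 uU vV uv Auv.
have sqrD x y : (x + y) ^+ 2 = x ^+ 2 + y ^+ 2 :> R.
  by rewrite exprDn_pchar // pnatE.
have uv2 : (u * v) ^+ 2 = u ^+ 8 + q ^+ 2 * v ^+ 8 by rewrite uv sqrD; ring.
have uv4 : (u * v) ^+ 4 = u ^+ 16 + q ^+ 4 * v ^+ 16.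
  by rewrite (exprM _ 2 2) uv2 sqrD; ring.
have AE : A = (U * V) ^+ 8 * ((u * v) ^+ 2 * (u * v) ^+ 4).
  transitivity (A * (u * v) ^+ 2 * (U * V) ^+ 2 * (u * U * (v * V)) ^+ 6).
    transitivity (A * (u * U * (v * V)) ^+ 8); last by ring.
    by rewrite uU vV mulr1 expr1n mulr1.
  by rewrite Auv; ring.
rewrite AE uv2 uv4.
transitivity ((u * U) ^+ 8 * (u ^+ 2 * V) ^+ 8
  + q ^+ 4 * v ^+ 8 * (u * U) ^+ 8 * (v * V) ^+ 8
  + q ^+ 2 * u ^+ 8 * (u * U) ^+ 8 * (v * V) ^+ 8
  + q ^+ 6 * (v * V) ^+ 8 * (v ^+ 2 * U) ^+ 8); first by ring.
by rewrite uU vV expr1n !mulr1 mul1r.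
Qed.

Lemma Ebot0 : Ebot 0 = 1.
Proof. by rewrite /Ebot /smul big_ord1 /spow /= /smul !big_ord1. Qed.

(** Modulo 2, squaring replaces q by q^2, so [Ebot] reduces to the square of [Etop], and [Aser] to
    the inverse of [Etop], the product of the sixth powers of [euler 1] and [euler 3]. *)
Lemma red_AserM : red 'F_2 Aser * (psi 1 * psi 3) ^+ 2 = 1.
Proof.
have top : red 'F_2 Etop = euler 1 ^+ 6 * euler 3 ^+ 6.
  by rewrite /Etop red_mul !red_pow.
have bot : red 'F_2 Ebot = euler 1 ^+ 12 * euler 3 ^+ 12.
  rewrite /Ebot red_mul !red_pow -/(euler 2) -/(euler 6).
  by rewrite -(euler_sqr 1 isT) -(euler_sqr 3 isT) -!exprM.
have botV := red_mulV (R := 'F_2) Ebot Ebot0.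
rewrite !psiE // /Aser red_mul top; move: botV; rewrite bot.
move: (red 'F_2 (sinv Ebot)) (euler 1) (euler 3) => W e1 e3 botV.
by rewrite -[RHS]botV; ring.
Qed.

Lemma psi_unit a : (0 < a)%N -> exists g, psi a * g = 1.
Proof.
move=> a0; have [g gE] := euler_unit a; exists (g ^+ 3).
by rewrite psiE // -exprMn gE expr1n.
Qed.

(** In [dissection8] with u = psi 1 and v = psi 3, the residues 2 and 4 come from q^2 u^8 and q^4
    v^8. Since [Aser] is q j_6^* modulo 2, they are the exponents 1 and 3 modulo 8 of j_6^*. *)
Lemma red_Aser_coef n :
  red 'F_2 Aser (8 * n + 2)%N = psi 1 n /\ red 'F_2 Aser (8 * n + 4)%N = psi 3 n.
Proof.
have [U uU] := psi_unit 1 isT; have [V vV] := psi_unit 3 isT.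
have := modular3.
(* Squaring twice turns psi 4 and psi 12 into (psi 1)^4 and (psi 3)^4, giving u v = u^4 + q v^4. *)
rewrite -(psi_sqr 2) // -(psi_sqr 6) // -(psi_sqr 1) // -(psi_sqr 3) // -!exprM => uv.
rewrite (dissection8 _ _ _ _ _ _ _ pchar_fps2 uU vV uv red_AserM).
rewrite !monX !mul1n -[X in X + _ + _ + _]mul1r -mon0.
by split; rewrite !fcoefD !fps2_oct_coef // ?add0r ?addr0.
Qed.

Lemma psi_coef0 a n : (forall t, a * tri t <> n)%N -> psi a n = 0.
Proof. by move=> an; rewrite /= big1 // => t _; case: eqP => // /an. Qed.

(** An odd coefficient at N = 8n + 3^m requires n = 3^m tri t, that is N = 3^m (2t + 1)^2. The
    constant 6 sits at N = 0 only, and 64 is even. *)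
Lemma Jstar6_even m N : (m <= 1)%N -> (N = 3 ^ m %[mod 8])%N ->
  (forall y, N <> 3 ^ m * y ^ 2)%N -> (2 %| Jstar6 N%:Z)%Z.
Proof.
move=> m1 N8 Ny.
have [n [NE AN]] : exists n, N = (8 * n + 3 ^ m)%N /\ red 'F_2 Aser N.+1 = psi (3 ^ m) n.
  exists (N %/ 8)%N; have [A2 A4] := red_Aser_coef (N %/ 8).
  have NE : N = (8 * (N %/ 8) + 3 ^ m)%N.
    by case: m m1 N8 {Ny} => [|[|]] // _; lia.
  split=> //; rewrite [in LHS]NE; case: m m1 {N8 Ny NE} => [|[|]] // _.
    by rewrite expn0 -A2 -addnS.
  by rewrite expn1 -A4 -addnS.
have N0 : (0 < N)%N by rewrite NE addn_gt0 expn_gt0 orbT.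
have A0 : (Aser N.+1)%:~R = 0 :> 'F_2.
  rewrite -[LHS]/(red 'F_2 Aser N.+1) AN psi_coef0 // => t tn.
  apply: (Ny (2 * t).+1); rewrite NE -tn.
  by have := tri2 t; nia.
case: N N0 A0 {N8 Ny NE AN} => // N _ A0.
rewrite /Jstar6 /= addr0.
rewrite (dvdz_pcharf (pchar_Fp (isT : prime 2))) rmorphD /= A0 add0r rmorphM /=.
by rewrite (_ : 64%:~R = 0) ?mul0r //; apply: val_inj.
Qed.

(** * Arithmetic of the progression *)

Lemma Jstar6_neg N : (0 < N)%N -> Jstar6 (Negz N) = 0.
Proof. by case: N. Qed.

(** The exponent of [p] is odd on the left and even on the right. *)
Lemma prime_mul_nsquare p a c y : prime p -> (0 < a)%N -> ~~ (p %| c)%N ->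
  (a ^ 2 * p * c <> y ^ 2)%N.
Proof.
move=> pp a0 pc eq.
have c0 : (0 < c)%N by case: c pc {eq}; rewrite ?dvdn0.
have := congr1 (logn p) eq; rewrite (lognX p y 2).
rewrite lognM ?muln_gt0 ?expn_gt0 ?a0 ?(prime_gt0 pp) //.
rewrite lognM ?expn_gt0 ?a0 ?(prime_gt0 pp) // (lognX p a 2) (logn_prime p pp) eqxx.
by rewrite (_ : logn p c = 0%N); [lia | rewrite lognE (negbTE pc) !andbF].
Qed.

Theorem theorem1p2 (k n m : nat) (p : nat -> nat) (j : int) :
  (m <= 1)%N ->
  (forall i, (1 <= i <= k.+1)%N ->
     prime (p i) /\ (p i %% 8 = 3 \/ p i %% 8 = 5 \/ p i %% 8 = 7)%N) ->
  ~~ (((p k.+1)%:Z) %| j)%Z ->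
  (2 %| Jstar6
      ((3 ^ m * (\prod_(1 <= i < k.+1) p i ^ 2) * p k.+1)%N%:Z
       * (8 * (p k.+1)%:Z * n%:Z + 8 * j + (p k.+1)%:Z)))%Z.
Proof.
move=> m1 pP pj.
have [pp p8] : prime (p k.+1) /\ (p k.+1 %% 8 = 3 \/ p k.+1 %% 8 = 5 \/ p k.+1 %% 8 = 7)%N.
  by apply: pP; rewrite ltnSn.
move: (p k.+1) pp p8 pj => r pr r8 rj.
(* The product of squares is the square of an odd number, hence 1 modulo 8. *)
have [a [a8 -> a0]] : exists a, [/\ (a ^ 2 %% 8 = 1)%N,
    (\prod_(1 <= i < k.+1) p i ^ 2 = a ^ 2)%N & (0 < a)%N].
  exists (\prod_(1 <= i < k.+1) p i)%N.
  rewrite (big_morph (fun x => x ^ 2)%N (fun x y => expnMn x y 2) (exp1n 2)).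
  split=> //; first rewrite big_nat_cond.
    apply: (big_ind (fun x => x %% 8 = 1)%N) => // [x y hx hy|i /andP [/andP [i0 ik] _]].
      by rewrite -modnMm hx hy.
    have [_ h] := pP i ltac:(lia).
    by rewrite -modnXm; case: h => [->|[->|->]].
  rewrite big_nat_cond; apply: prodn_cond_gt0 => i /andP [/andP [i0 ik] _].
  by apply: prime_gt0; have [] := pP i ltac:(lia).
have r2 : (r ^ 2 %% 8 = 1)%N by rewrite -modnXm; case: r8 => [->|[->|->]].
set c := _ + r%:Z; pose f := r%:Z * n%:Z + j.
have cE : c = 8 * f + r%:Z by rewrite /c /f; ring.
(* If [r] divided [c], it would divide 8j, hence j, because [r] is odd. *)
have rc : ~~ (r%:Z %| c)%Z.
  apply: contra rj => /dvdzP [q qE].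
  rewrite -(@Gauss_dvdzr _ 8); first by apply/dvdzP; exists (q - 1 - 8 * n%:Z); lia.
  by rewrite coprimezE /= (@coprimeXr 3 r 2) // coprimen2; lia.
(* As c = 8f + r, the argument is 3^m a^2 (8rf + r^2), and both a^2 and r^2 are 1 modulo 8. *)
have [e De] : exists e : int, (3 ^ m * a ^ 2 * r)%N%:Z * c = 8 * e + (3 ^ m)%N%:Z.
  have [x xE] : exists x, (a ^ 2 = 8 * x + 1)%N by exists (a ^ 2 %/ 8)%N; lia.
  have [y yE] : exists y, (r ^ 2 = 8 * y + 1)%N by exists (r ^ 2 %/ 8)%N; lia.
  move: (3 ^ m)%N => t; exists (t%:Z * ((a ^ 2)%N%:Z * r%:Z * f + 8 * x%:Z * y%:Z + x%:Z + y%:Z)).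
  have yE' : r%:Z * r%:Z = 8 * y%:Z + 1 by lia.
  transitivity (t%:Z * (a ^ 2)%N%:Z * (8 * r%:Z * f + r%:Z * r%:Z)).
    by rewrite cE !PoszM; ring.
  by rewrite yE' xE PoszD PoszM; ring.
have D0 : (0 < 3 ^ m * a ^ 2 * r)%N by rewrite !muln_gt0 !expn_gt0 a0 (prime_gt0 pr).
(* For c >= 0, an argument of the form 3^m y^2 would make a^2 r c a square. *)
move: c rc De {cE} => [] c' rc De.
  rewrite -PoszM; apply: (Jstar6_even m) => //.
    by move: De; rewrite -PoszM; case: (m) m1 => [|[|]] // _; lia.
  have -> : (3 ^ m * a ^ 2 * r * c' = 3 ^ m * (a ^ 2 * r * c'))%N by rewrite !mulnA.
  move=> y /eqP; rewrite eqn_pmul2l ?expn_gt0 // => /eqP.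
  exact: (prime_mul_nsquare r a c' y pr a0 rc).
(* For c < 0 the coefficient is zero except at -1, where it is 1; but the argument is 1 or 3 modulo
   8, while -1 is 7. *)
move: De D0; set D := (_ * r)%N => De D0.
have K0 : (0 < D * c'.+1)%N by rewrite muln_gt0 D0.
move: De; have -> : D%:Z * Negz c' = Negz (D * c'.+1).-1.
  by rewrite !NegzE mulrN -PoszM prednK.
move: {D D0} (D * c'.+1)%N K0 => K K0 De; rewrite Jstar6_neg //.
by move: De; case: (m) m1 => [|[|]] // _; lia.
Qed.
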